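(* Let $N\ge1$ and let $\mu$ be a probability measure on the unit circle $\mathbb{T}$ whose support has cardinality at least $N+1$. Let $\varphi_0,\dots,\varphi_N$ be the normalized orthogonal polynomials of $\mu$, $\varphi_N^\star$ the normalized reversed polynomial, and $c_1,\dots,c_N$ the canonical moments of $\mu$. Set $\pi_k=\langle\varphi_N^\star,\varphi_k\rangle$ for $k=0,1,\dots,N$, $z=(z_1,\dots,z_N):=(\pi_N,\pi_{N-1},\dots,\pi_1)$ and $\kappa_r=-\overline{c_{N+1-r}}$ for $r=1,\dots,N$. Then $z$ lies in the complex ball $\mathbb{B}_{N,2}^{\mathbb{C}}$, and $$z_1=\kappa_1,\qquad z_j=\kappa_j\prod_{s=1}^{j-1}\sqrt{1-|\kappa_s|^2},\quad j=2,\dots,N.$$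
   Context: $\mathbb{T}=\{z\in\mathbb{C}:|z|=1\}$; $\mathbb{B}_{N,2}^{\mathbb{C}}=\{z\in\mathbb{C}^N:\sum_{i=1}^N|z_i|^2<1\}$. The inner product in $L^2(\mathbb{T},\mu)$ is $\langle f,g\rangle=\int\overline{f}\,g\,d\mu$, with norm $\|\cdot\|$. For $0\le n\le N$, $\Phi_n$ is the monic orthogonal polynomial of degree $n$: $\Phi_0\equiv1$ and $\Phi_n$ is the orthogonal projection of $z^n$ onto $\{1,z,\dots,z^{n-1}\}^\perp$ in $L^2(\mathbb{T},\mu)$. The reversed polynomials are $\Phi_n^\star(z)=z^n\overline{\Phi_n(1/\bar z)}$. The normalized polynomials are $\varphi_n=\Phi_n/\|\Phi_n\|$ and $\varphi_n^\star=\Phi_n^\star/\|\Phi_n\|$. The canonical moments (Verblunsky coefficients) of $\mu$ are $c_j=-\overline{\Phi_j(0)}$. *)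

(* Defs.v *)
From HB Require Import structures.
From mathcomp Require Import all_boot all_order all_algebra.
From mathcomp Require Import complex.
From mathcomp Require Import all_classical all_reals all_analysis.

Set Implicit Arguments.
Unset Strict Implicit.
Unset Printing Implicit Defensive.

Import Order.TTheory GRing.Theory Num.Theory.
Import numFieldNormedType.Exports.

Local Open Scope classical_set_scope.
Local Open Scope ring_scope.

(* The regular module [R[i]^o] is what carries the topology of the norm. *)
Definition unit_circle (R : realType) : set R[i]^o := [set z | `|z| = 1].
Arguments unit_circle R : clear implicits.

(* [set_type] has the subspace topology. *)
Definition circle (R : realType) : Type := set_type (unit_circle R).

HB.instance Definition _ (R : realType) :=
  Topological.copy (circle R) (set_type (unit_circle R)).

Lemma one_unit_circle (R : realType) : (1 : R[i]^o) \in unit_circle R.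
Proof. by rewrite inE /unit_circle /= normr1. Qed.

HB.instance Definition _ (R : realType) :=
  isPointed.Build (circle R) (exist _ (1 : R[i]^o) (one_unit_circle R)).

Definition circle_val (R : realType) (x : circle R) : R[i] := set_val x.

(* The circle with its Borel sigma-algebra. *)
Definition borel_circle (R : realType) : measurableType _ :=
  g_sigma_algebraType (@open (circle R)).

Coercion circle_val : circle >-> complex.

Section OrthogonalPolynomials.
Context {R : realType}.
Variable mu : probability (borel_circle R) R.

Implicit Types (f g h s : circle R -> R[i]) (S V : set (circle R -> R[i])).

(* The topological support: the smallest closed set of full measure. *)
Definition msupport : set (circle R) :=
  [set x | forall U : set (circle R), open U -> U x -> (0 < mu U)%E].

Definition cintegral f : R[i] :=
  Complex (\int[mu]_x @complex.Re R (f x)) (\int[mu]_x @complex.Im R (f x)).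

Definition L2 : set (circle R -> R[i]) :=
  [set f : circle R -> R[i] |
    (@complex.Re R \o f \in Lfun mu 2%:E) /\
    (@complex.Im R \o f \in Lfun mu 2%:E)].

(* Conjugate-linear in the first argument. *)
Definition inner f g : R[i] := cintegral (fun x => (f x)^* * g x).

(* [sqrtC] is the nonnegative root when its argument is a nonnegative real. *)
Definition L2norm f : R[i] := sqrtC (inner f f).

Definition orthogonal_complement S : set (circle R -> R[i]) :=
  [set h : circle R -> R[i] | L2 h /\ forall s, S s -> inner s h = 0].

(* [g] represents (up to a null set) the orthogonal projection of [f] on [V]. *)
Definition is_orthogonal_projection V f g : Prop :=
  V g /\ forall h, V h -> inner h (f - g) = 0.

Definition monomial (k : nat) (x : circle R) : R[i] := (x : R[i]) ^+ k.

Definition monomials_below (n : nat) : set (circle R -> R[i]) :=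
  [set monomial k | k in [set k | (k < n)%N]].

(* The projection is an element of L^2, that is, a function up to null sets; it
   is the monic polynomial of degree [n] representing it that is meant, since
   its value at 0 is used.  This polynomial exists, and is unique as soon as the
   support has at least [n] points. *)
Definition is_monic_orthogonal_poly (n : nat) (P : {poly R[i]}) : Prop :=
  [/\ P \is monic, size P = n.+1 &
      is_orthogonal_projection (orthogonal_complement (monomials_below n))
        (monomial n) (fun x => P.[x])].

Definition Phi (n : nat) : {poly R[i]} := xget 0 (is_monic_orthogonal_poly n).

Definition Phi_fun (n : nat) (x : circle R) : R[i] := (Phi n).[x].

(* Only as a function on the circle, where [x] is nonzero: at 0 the formula would
   need the polynomial extension. *)
Definition Phi_star (n : nat) (x : circle R) : R[i] :=
  (x : R[i]) ^+ n * ((Phi n).[1 / (x : R[i])^*])^*.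

Definition phi (n : nat) (x : circle R) : R[i] :=
  Phi_fun n x / L2norm (Phi_fun n).

Definition phi_star (n : nat) (x : circle R) : R[i] :=
  Phi_star n x / L2norm (Phi_fun n).

Definition canonical_moment (j : nat) : R[i] := - ((Phi j).[0])^*.

End OrthogonalPolynomials.

Definition complex_ball (R : realType) (N : nat) : set 'rV[R[i]]_N :=
  [set z | \sum_(i < N) `|z ord0 i| ^+ 2 < 1].

(* Main.v *)
Require Import Defs.
From mathcomp Require Import all_boot all_order all_algebra.
From mathcomp Require Import complex.
From mathcomp Require Import all_classical all_reals all_analysis.
From mathcomp Require Import measurable_realfun ring.
Set Implicit Arguments.
Unset Strict Implicit.
Unset Printing Implicit Defensive.

Import Order.TTheory GRing.Theory Num.Theory.
Import numFieldNormedType.Exports.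
Local Open Scope classical_set_scope.
Local Open Scope ring_scope.

(* On the circle, <z^j, Phi_N^*> is the conjugate of <z^(N-j), Phi_N>, so
   Phi_N^* is orthogonal to z, ..., z^N and <Phi_N^*, q> = q(0) ||Phi_N||^2 for
   every polynomial q of degree at most N.  Hence
   pi_k = Phi_k(0) ||Phi_N|| / ||Phi_k||, and the Szego recursion gives
   ||Phi_(k+1)||^2 = (1 - |Phi_(k+1)(0)|^2) ||Phi_k||^2, which turns the ratio of
   norms into the product.  It also makes |pi_k|^2 telescope: the sum over
   k = 1, ..., N is 1 - ||Phi_N||^2, and ||Phi_N|| > 0 because Phi_N cannot
   vanish at N + 1 points of the support. *)

(** For [p] of degree at most [n] this is z^n times the conjugate of p(1 / conj z). Giving it by
    coefficients makes it a polynomial, with a value at 0. *)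
Definition reversed_poly (C : numClosedFieldType) (n : nat) (p : {poly C}) : {poly C} :=
  \poly_(i < n.+1) (p`_(n - i))^*.

(** * Szego theory for an abstract shift-invariant sesquilinear form on polynomials *)

Section Szego.
Variables (C : numClosedFieldType) (B : {poly C} -> {poly C} -> C) (N : nat).
Hypothesis BDr : forall p q r : {poly C}, B p (q + r) = B p q + B p r.
Hypothesis BZr : forall (p : {poly C}) a (q : {poly C}), B p (a *: q) = a * B p q.
Hypothesis BC : forall p q, B q p = (B p q)^*.
Hypothesis BX : forall p q : {poly C}, B ('X * p) ('X * q) = B p q.
Hypothesis B_gt0 : forall p : {poly C}, p != 0 -> (size p <= N.+1)%N -> 0 < B p p.

Definition monic_orthogonal (n : nat) (p : {poly C}) : Prop :=
  [/\ p \is monic, size p = n.+1 & forall k, (k < n)%N -> B 'X^k p = 0].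

Implicit Types (p q r : {poly C}) (n k : nat).

Lemma formBr p q r : B p (q - r) = B p q - B p r.
Proof. by rewrite -scaleN1r BDr BZr mulN1r. Qed.

Lemma formDl p q r : B (q + r) p = B q p + B r p.
Proof. by rewrite BC BDr rmorphD /= -!BC. Qed.

Lemma formZl p a q : B (a *: q) p = a^* * B q p.
Proof. by rewrite BC BZr rmorphM /= -BC. Qed.

Lemma form_sumr (I : Type) (s : seq I) (F : I -> {poly C}) p :
  B p (\sum_(i <- s) F i) = \sum_(i <- s) B p (F i).
Proof.
apply: (big_morph (B p)) => [q r|]; first exact: BDr.
by rewrite -(scale0r 0) BZr mul0r.
Qed.

Lemma form_suml (I : Type) (s : seq I) (F : I -> {poly C}) p :
  B (\sum_(i <- s) F i) p = \sum_(i <- s) B (F i) p.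
Proof.
by rewrite BC form_sumr rmorph_sum /=; apply: eq_bigr => i _; rewrite -BC.
Qed.

(** The Gram matrix of the monomials is Toeplitz, because multiplication by ['X] preserves the
    form. *)
Lemma form_shift a b k : B 'X^(k + a) 'X^(k + b) = B 'X^a 'X^b.
Proof. by elim: k => // k IH; rewrite !addSn !exprS BX. Qed.

Lemma poly_sum_wide n p : (size p <= n)%N -> p = \sum_(i < n) p`_i *: 'X^i.
Proof.
move=> sp; rewrite -poly_def; apply/polyP => i; rewrite coef_poly.
by case: ltnP => // /(leq_trans sp) /leq_sizeP ->.
Qed.

Lemma orthogonal_lower n p q : (forall k, (k < n)%N -> B 'X^k p = 0) ->
  (size q <= n)%N -> B q p = 0.
Proof.
move=> p_orth sq; rewrite (poly_sum_wide sq) form_suml big1 // => i _.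
by rewrite formZl p_orth // mulr0.
Qed.

Lemma size_reversed n p : (size (reversed_poly n p) <= n.+1)%N.
Proof. exact: size_poly. Qed.

(** Both sides expand over the coefficients of [p]; after reversing the order of summation, the
    terms agree by the Toeplitz property. *)
Lemma form_reversed n p j : (size p <= n.+1)%N -> (j <= n)%N ->
  B 'X^j (reversed_poly n p) = B p 'X^(n - j).
Proof.
move=> sp jn; rewrite {2}(poly_sum_wide sp) form_suml /reversed_poly poly_def.
rewrite form_sumr (reindex_inj rev_ord_inj) /=; apply: eq_bigr => i _.
rewrite BZr formZl subSS subKn ?leq_ord //; congr (_ * _).
have i_n : (i <= n)%N by rewrite -ltnS.
(* Both moments have exponent difference n - i - j. The one with the smaller first exponent is
   shifted up by |i - j|. *)
have [ij|/ltnW ji] := leqP i j.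
  rewrite -(form_shift i (n - j) (j - i)); congr (B 'X^_ 'X^_); first by rewrite subnK.
  by rewrite addnC addnBA // subnK.
rewrite -(form_shift j (n - i) (i - j)); congr (B 'X^_ 'X^_); first by rewrite subnK.
by rewrite addnC addnBA // subnK.
Qed.

Lemma size_monic_subr n p q : p \is monic -> size p = n.+1 ->
  q \is monic -> size q = n.+1 -> (size (p - q)%R <= n)%N.
Proof.
move=> /monicP pm sp /monicP qm sq; apply/leq_sizeP => j nj; rewrite coefB.
have [->|nej] := eqVneq j n.
  by move: pm qm; rewrite /lead_coef sp sq /= => -> ->; rewrite subrr.
by rewrite !nth_default ?subrr // ?sp ?sq ltn_neqAle eq_sym nej.
Qed.

(** The difference [p - 'X^n] has degree below [n], so [p] is orthogonal to it. *)
Lemma monic_orthogonal_Xn n p : monic_orthogonal n p -> B p 'X^n = B p p.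
Proof.
move=> [pm sp po]; apply/eqP; rewrite eq_sym -subr_eq0 -formBr BC.
rewrite (orthogonal_lower po) ?conjC0 //.
by apply: size_monic_subr => //; rewrite ?monicXn ?size_polyXn.
Qed.

(* The reversed polynomial represents, up to normalization, the evaluation at 0
   on polynomials of degree at most n. *)
Lemma reversed_eval0 n p q : monic_orthogonal n p -> (size q <= n.+1)%N ->
  B (reversed_poly n p) q = q`_0 * B p p.
Proof.
move=> pP sq; have [pm sp po] := pP.
rewrite {1}(poly_sum_wide sq) form_sumr big_ord_recl big1 => [|i _].
  rewrite addr0 BZr BC form_reversed ?sp // subn0 (monic_orthogonal_Xn pP).
  by rewrite -BC.
rewrite BZr BC form_reversed ?sp //; last exact: ltn_ord.
by rewrite -BC po ?mulr0 // ltn_subrL /= (leq_trans _ (ltn_ord i)).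
Qed.

Lemma monic_orthogonal_gt0 n p : (n <= N)%N -> monic_orthogonal n p -> 0 < B p p.
Proof. by move=> nN [pm sp _]; apply: B_gt0; rewrite ?monic_neq0 // sp ltnS. Qed.

(** The difference has degree below [n], so it is orthogonal to both polynomials and hence to
    itself. Its size is at most [N.+1], where the form is definite. *)
Lemma monic_orthogonal_uniq n p q : (n <= N.+1)%N ->
  monic_orthogonal n p -> monic_orthogonal n q -> p = q.
Proof.
move=> nN [pm sp po] [qm sq qo]; apply/eqP; rewrite -subr_eq0; apply/negP => /negP d0.
have sd : (size (p - q)%R <= n)%N by exact: size_monic_subr.
have := B_gt0 d0 (leq_trans sd nN).
by rewrite (formBr (p - q) p q) !(orthogonal_lower _ sd) ?subrr ?ltxx.
Qed.

Lemma reversed_coef0 n p : p \is monic -> size p = n.+1 -> (reversed_poly n p)`_0 = 1.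
Proof.
move=> /monicP; rewrite /lead_coef => + sp; rewrite sp /= => pn.
by rewrite coef_poly /= subn0 pn conjC1.
Qed.

(** Both ['X * p] and the reversed polynomial are orthogonal to z, ..., z^n. The coefficient is the
    one that also cancels the product with 1, since <1, reversed p> = <p, p>. *)
Lemma szego_recursion n p : (n <= N)%N -> monic_orthogonal n p ->
  monic_orthogonal n.+1 ('X * p - (B 1 ('X * p) / B p p) *: reversed_poly n p).
Proof.
move=> nN pP; have [pm sp po] := pP; have p_gt0 := monic_orthogonal_gt0 nN pP.
set a := _ / _.
have s1 : size ('X * p) = n.+2 by rewrite mulrC size_mulX ?monic_neq0 // sp.
have s2 : (size (- (a *: reversed_poly n p)) < n.+2)%N.
  by rewrite size_polyN ltnS (leq_trans (size_scale_leq _ _)) ?size_reversed.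
have l1 : lead_coef ('X * p) = 1 by rewrite mulrC lead_coefMX; apply/monicP.
split.
- by rewrite monicE lead_coefDl ?s1 // l1.
- by rewrite size_polyDl s1.
- case=> [_|k kn]; rewrite formBr BZr.
    have -> : B 'X^0 (reversed_poly n p) = B p p.
      by rewrite form_reversed ?sp // subn0 (monic_orthogonal_Xn pP).
    by rewrite expr0 /a divfK ?subrr ?gt_eqF.
  rewrite form_reversed ?sp // exprS BX po // BC po ?conjC0 ?mulr0 ?subrr //.
  by rewrite ltn_subrL /= (leq_ltn_trans _ (kn : (k < n)%N)).
Qed.

(** The recursion started at 1 is the construction. It reaches degree [N.+1] because each step
    divides by a norm in degree at most [N]. *)
Lemma monic_orthogonal_exists n : (n <= N.+1)%N -> exists p, monic_orthogonal n p.
Proof.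
elim: n => [_|n IH nN]; first by exists 1; split; rewrite ?monic1 ?size_poly1.
have [p pP] := IH (ltnW nN).
by eexists; apply: szego_recursion pP.
Qed.

(** By uniqueness ['X * p] is [q] plus [a] times the reversed polynomial, with a = -q(0). The two
    summands are orthogonal and the reversed polynomial has the norm of [p], so this is
    Pythagoras. *)
Lemma monic_orthogonal_normS n p q : (n <= N)%N ->
  monic_orthogonal n p -> monic_orthogonal n.+1 q ->
  B q q = (1 - `|q`_0| ^+ 2) * B p p.
Proof.
move=> nN pP qP; have [pm sp _] := pP; have [_ _ qo] := qP.
have := szego_recursion nN pP; set a := _ / _.
move=> /(monic_orthogonal_uniq (nN : (n.+1 <= N.+1)%N) qP) qE.
have q0 : q`_0 = - a.
  by rewrite qE coefB coefXM coefZ reversed_coef0 // mulr1 sub0r.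
have XpE : 'X * p = q + a *: reversed_poly n p by rewrite qE subrK.
have rq : B (reversed_poly n p) q = 0 by rewrite (orthogonal_lower qo) ?size_reversed.
have qr : B q (reversed_poly n p) = 0 by rewrite BC rq conjC0.
have := BX p p; rewrite XpE formDl !BDr !formZl !BZr rq qr.
rewrite reversed_eval0 ?size_reversed // reversed_coef0 // q0 normrN normCK => pp.
have -> : B q q = B p p - a^* * (a * (1 * B p p)) by rewrite -{1}pp; ring.
by ring.
Qed.

(** Induction on [j]: the factor at [s] accounts for replacing degree [N.+1 - s] by [N - s] in the
    denominator. *)
Lemma sqrt_norm_ratio (P : nat -> {poly C}) j :
  (forall k, (k <= N)%N -> monic_orthogonal k (P k)) -> (1 <= j <= N.+1)%N ->
  sqrtC (B (P N) (P N)) / sqrtC (B (P (N.+1 - j)%N) (P (N.+1 - j)%N)) =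
  \prod_(1 <= s < j) sqrtC (1 - `|(P (N.+1 - s)%N)`_0| ^+ 2).
Proof.
move=> PP; elim: j => // -[_ _|j IH /= jN].
  rewrite subSS subn0 big_geq // divff // sqrtC_eq0 gt_eqF //.
  exact: monic_orthogonal_gt0 (PP _ _).
rewrite big_nat_recr //= -IH ?(ltnW jN) // !subSS.
have jN' : (j <= N)%N by rewrite ltnW.
have := monic_orthogonal_normS (leq_subr j.+1 N) (PP _ (leq_subr _ _)).
rewrite subnSK // => /(_ _ (PP _ (leq_subr _ _))) nE.
have n_gt0 k : (k <= N)%N -> 0 < B (P k) (P k).
  by move=> kN; exact: monic_orthogonal_gt0 kN (PP _ kN).
have nS := n_gt0 _ (leq_subr j.+1 N); have nj := n_gt0 _ (leq_subr j N).
(* The sign follows from the positivity of both norms; it allows the complex square root to be split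
   over the product. *)
have e_ge0 : 0 <= 1 - `|(P (N - j)%N)`_0| ^+ 2.
  by rewrite -(pmulr_lge0 _ nS) -nE ltW.
have -> : sqrtC (B (P (N - j)%N) (P (N - j)%N)) =
    sqrtC (1 - `|(P (N - j)%N)`_0| ^+ 2) * sqrtC (B (P (N - j.+1)%N) (P (N - j.+1)%N)).
  by rewrite nE rootCMl.
rewrite invfM mulrA -mulrA mulrAC -!mulrA divff ?mulr1 //.
apply: contraTneq nj => e0.
by rewrite nE; move/eqP: e0; rewrite sqrtC_eq0 => /eqP ->; rewrite mul0r ltxx.
Qed.

Lemma sum_sqr_projections (P : nat -> {poly C}) :
  (forall k, (k <= N)%N -> monic_orthogonal k (P k)) ->
  \sum_(i < N) `|(P (N - i)%N)`_0 *
     (sqrtC (B (P N) (P N)) / sqrtC (B (P (N - i)%N) (P (N - i)%N)))| ^+ 2 =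
  1 - B (P N) (P N) / B (P 0) (P 0).
Proof.
move=> PP.
have n_gt0 k : (k <= N)%N -> 0 < B (P k) (P k).
  by move=> kN; exact: monic_orthogonal_gt0 kN (PP _ kN).
(* The norm recursion gives |P_(N-i)(0)|^2 = 1 - ||P_(N-i)||^2 / ||P_(N-i-1)||^2, so each summand is
   an increment of [u]. *)
pose u i := - (B (P N) (P N) / B (P (N - i)%N) (P (N - i)%N)).
rewrite (eq_bigr (fun i : 'I_N => u i.+1 - u i)) => [|i _]; last first.
  have := monic_orthogonal_normS (leq_subr i.+1 N) (PP _ (leq_subr _ _)).
  rewrite subnSK // => /(_ _ (PP _ (leq_subr _ _))) nE.
  have nS := n_gt0 _ (leq_subr i.+1 N); have ni := n_gt0 _ (leq_subr i N).
  have r_ge0 : 0 <= sqrtC (B (P N) (P N)) / sqrtC (B (P (N - i)%N) (P (N - i)%N)).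
    by rewrite divr_ge0 ?sqrtC_ge0 ?ltW ?n_gt0 ?leq_subr.
  rewrite normrM exprMn (ger0_norm r_ge0) expr_div_n !sqrtCK.
  have -> : `|(P (N - i)%N)`_0| ^+ 2 =
      1 - B (P (N - i)%N) (P (N - i)%N) / B (P (N - i.+1)%N) (P (N - i.+1)%N).
    by rewrite nE mulfK ?gt_eqF // opprB addrC subrK.
  rewrite /u; field.
  by rewrite !gt_eqF.
rewrite -(big_mkord xpredT (fun i => u i.+1 - u i)) telescope_sumr // /u.
by rewrite subn0 subnn divff ?opprK ?gt_eqF ?n_gt0 // addrC.
Qed.

End Szego.

(** * Continuity of real and imaginary parts and of polynomial functions *)

Lemma continuous_Re (R : realType) : continuous (@complex.Re R : R[i]^o -> R).
Proof.
move=> x; have FF : Filter (nbhs (x : R[i]^o)) by exact: nbhs_filter.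
apply/cvgrPdist_lt => e e0.
have : \forall t \near (x : R[i]^o), ball (x : R[i]^o) e%:C%C t.
  by apply: nbhsx_ballx; rewrite ltcR.
apply: filterS => t; rewrite -ball_normE /=.
rewrite -(raddfB (@complex.Re R : Rcomplex R -> R)) -ltcR.
by apply: le_lt_trans; exact: normc_ge_Re.
Qed.

(** Reduced to the real part through Im y = - Re (y i). *)
Lemma continuous_Im (R : realType) : continuous (@complex.Im R : R[i]^o -> R).
Proof.
move=> x; have -> : @complex.Im R = fun y : R[i]^o => - complex.Re (y * 'i%C).
  by apply/funext => y; rewrite ReiNIm opprK.
have FF : Filter (nbhs (x : R[i]^o)) by exact: nbhs_filter.
apply: (@cvgN _ R^o _ (nbhs (x : R[i]^o)) FF (fun y => complex.Re (y * 'i%C))).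
apply: (@continuous_comp R[i]^o R[i]^o R^o (fun y => y * 'i%C) (@complex.Re R)).
  exact: mulrr_continuous.
exact: continuous_Re.
Qed.

Section ContinuousComplex.
Variables (R : realType) (T : topologicalType) (f : T -> R[i]^o).
Hypothesis cf : continuous f.

Lemma continuous_Re_comp : continuous (fun x => complex.Re (f x)).
Proof.
move=> x; apply: (@continuous_comp _ R[i]^o R^o f (@complex.Re R)).
  exact: cf.
exact: continuous_Re.
Qed.

Lemma continuous_Im_comp : continuous (fun x => complex.Im (f x)).
Proof.
move=> x; apply: (@continuous_comp _ R[i]^o R^o f (@complex.Im R)).
  exact: cf.
exact: continuous_Im.
Qed.

Lemma continuous_sqr_normc : continuous (fun x =>
  complex.Re (f x) * complex.Re (f x) + complex.Im (f x) * complex.Im (f x) : R^o).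
Proof.
move=> x; apply: cvgD; apply: cvgM;
  by [exact: continuous_Re_comp|exact: continuous_Im_comp].
Qed.

End ContinuousComplex.

Lemma continuous_horner_comp (K : numFieldType) (T : topologicalType)
  (f : T -> K^o) (p : {poly K}) :
  continuous f -> continuous (fun x => p.[f x] : K^o).
Proof.
move=> cf; elim/poly_ind: p => [|p c IH] x.
  have -> : (fun x => (0 : {poly K}).[f x] : K^o) = cst 0.
    by apply/funext => y; rewrite horner0.
  exact: cvg_cst.
have -> : (fun x => (p * 'X + c%:P).[f x] : K^o) = fun x => (p.[f x] * f x + c : K^o).
  by apply/funext => y; rewrite hornerMXaddC.
by apply: cvgD; [apply: cvgM; [exact: IH|exact: cf]|exact: cvg_cst].
Qed.

(** * Conjugation, continuity and measurability on the unit circle *)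

Section CircleFunctions.
Variable R : realType.

Lemma continuous_circle_val : continuous (fun x : circle R => (x : R[i]) : R[i]^o).
Proof. exact: initial_continuous. Qed.

Lemma circle_norm (x : circle R) : `|x : R[i]| = 1.
Proof. by case: x => z /= zP; exact: (set_mem zP). Qed.

Lemma circle_conj (x : circle R) : (x : R[i])^* = (x : R[i])^-1.
Proof. by rewrite invC_norm circle_norm expr1n invr1 mul1r. Qed.

Lemma circle_neq0 (x : circle R) : (x : R[i]) != 0.
Proof. by rewrite -normr_gt0 circle_norm. Qed.

Lemma continuous_circle_horner (p : {poly R[i]}) :
  continuous (fun x : circle R => p.[x] : R[i]^o).
Proof. exact/continuous_horner_comp/continuous_circle_val. Qed.

Lemma measurable_circle_continuous (f : circle R -> R) : continuous f ->
  measurable_fun [set: borel_circle R] f.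
Proof.
move=> /continuousP cf; apply: (measurability _ (RGenOpens.measurableE R)).
move=> _ [_ [a [b ->] <-]]; rewrite setTI; apply: sub_sigma_algebra.
exact/cf/interval_open.
Qed.

End CircleFunctions.

Lemma Re_conjM (R : realType) (u v : R[i]) :
  complex.Re (u^* * v) = complex.Re u * complex.Re v + complex.Im u * complex.Im v.
Proof. by case: u v => [a b] [c d] /=; rewrite mulNr opprK. Qed.

Lemma Im_conjM (R : realType) (u v : R[i]) :
  complex.Im (u^* * v) = complex.Re u * complex.Im v - complex.Im u * complex.Re v.
Proof. by case: u v => [a b] [c d] /=; rewrite mulNr. Qed.

(** * The inner product of L^2: sesquilinearity and positivity *)

Section Inner.
Variables (R : realType) (mu : probability (borel_circle R) R).
Implicit Types f g h : circle R -> R[i].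

Definition cintegrable f :=
  mu.-integrable [set: borel_circle R] (EFin \o (@complex.Re R \o f)) /\
  mu.-integrable [set: borel_circle R] (EFin \o (@complex.Im R \o f)).

Lemma cintegralD f g : cintegrable f -> cintegrable g ->
  cintegral mu (fun x => f x + g x) = cintegral mu f + cintegral mu g.
Proof.
move=> [f1 f2] [g1 g2]; rewrite /cintegral.
rewrite (_ : Complex (Rintegral mu _ _) _ + _ =
  Complex (\int[mu]_x (complex.Re (f x)) + \int[mu]_x (complex.Re (g x)))
  (\int[mu]_x (complex.Im (f x)) + \int[mu]_x (complex.Im (g x)))) //.
rewrite -!RintegralD //; congr Complex; apply: eq_Rintegral => x _.
  by rewrite (raddfD (@complex.Re R : Rcomplex R -> R)).
by rewrite (raddfD (@complex.Im R : Rcomplex R -> R)).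
Qed.

Lemma cintegralZ a f : cintegrable f ->
  cintegral mu (fun x => a * f x) = a * cintegral mu f.
Proof.
case: a => a b [f1 f2]; rewrite /cintegral.
rewrite -[RHS]/(Complex (a * \int[mu]_x (complex.Re (f x)) - b * \int[mu]_x (complex.Im (f x)))
  (a * \int[mu]_x (complex.Im (f x)) + b * \int[mu]_x (complex.Re (f x)))).
have int c (h : circle R -> R) : mu.-integrable [set: borel_circle R] (EFin \o h) ->
    mu.-integrable [set: borel_circle R] (EFin \o (fun x => c * h x)).
  by move=> hi; exact: (integrableZl measurableT c hi).
rewrite -!RintegralZl // -RintegralB -?RintegralD //; try exact: int.
by congr Complex; apply: eq_Rintegral => x _; case: (f x).
Qed.

Lemma cintegral_conj f : cintegrable f ->
  cintegral mu (fun x => (f x)^*) = (cintegral mu f)^*.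
Proof.
move=> [f1 f2]; rewrite /cintegral -[RHS]/(Complex _ (- \int[mu]_x (complex.Im (f x)))).
rewrite -mulN1r -RintegralZl //; congr Complex; apply: eq_Rintegral => x _.
  by case: (f x).
by rewrite mulN1r; case: (f x).
Qed.

Lemma L2D f g : L2 mu f -> L2 mu g -> L2 mu (fun x => f x + g x).
Proof.
have addL (u v : circle R -> R) : u \in Lfun mu 2%:E -> v \in Lfun mu 2%:E ->
    (fun x => u x + v x) \in Lfun mu 2%:E.
  by move=> uL vL; exact: (Lfun_addr_closed mu (lee1n 2)).2.
move=> [f1 f2] [g1 g2]; split.
  rewrite (_ : _ \o _ = fun x => (@complex.Re R \o f) x + (@complex.Re R \o g) x).
    exact: addL.
  by apply/funext => x /=; rewrite (raddfD (@complex.Re R : Rcomplex R -> R)).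
rewrite (_ : _ \o _ = fun x => (@complex.Im R \o f) x + (@complex.Im R \o g) x).
  exact: addL.
by apply/funext => x /=; rewrite (raddfD (@complex.Im R : Rcomplex R -> R)).
Qed.

Lemma L2Z a f : L2 mu f -> L2 mu (fun x => a * f x).
Proof.
(* The real and imaginary parts of [a * f] are real linear combinations of those of [f]. *)
have comb b c (u v : circle R -> R) : u \in Lfun mu 2%:E -> v \in Lfun mu 2%:E ->
    (fun x => b * u x + c * v x) \in Lfun mu 2%:E.
  have scaleL d (w : circle R -> R) : w \in Lfun mu 2%:E -> d *: w \in Lfun mu 2%:E.
    move=> wL; have [L0 LP] := Lfun_submod_closed mu (lee1n 2).
    by rewrite -[d *: w]addr0; exact: LP.
  by move=> uL vL; apply: (Lfun_addr_closed mu (lee1n 2)).2; exact: scaleL.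
case: a => a b [f1 f2]; split.
  rewrite (_ : _ \o _ = fun x => a * (@complex.Re R \o f) x + (- b) * (@complex.Im R \o f) x).
    exact: comb.
  by apply/funext => x /=; case: (f x) => c d /=; rewrite mulNr.
rewrite (_ : _ \o _ = fun x => a * (@complex.Im R \o f) x + b * (@complex.Re R \o f) x).
  exact: comb.
by apply/funext => x /=; case: (f x) => c d /=.
Qed.

(** The square is at most 1 and the total mass is 1. *)
Lemma Lfun2_bounded (u : circle R -> R) : measurable_fun [set: borel_circle R] u ->
  (forall x, `|u x| <= 1) -> u \in Lfun mu 2%:E.
Proof.
move=> mf ub; rewrite inE/=; apply/andP; split; rewrite inE //=.
rewrite /finite_norm unlock poweR_lty //.
apply: (@le_lt_trans _ _ (\int[mu]_x (cst 1%E x))%E).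
  apply: ge0_le_integral => //=.
  - apply/measurable_EFinP/(@measurableT_comp _ _ _ _ _ _ (@powR R ^~ 2)) => //.
    exact: measurableT_comp.
  - by move=> x _; rewrite lee_fin -[leRHS]/((fun=> 1) (2 : R)) -powR1 ge0_ler_powR ?nnegrE.
by rewrite integral_cst //= mul1e probability_setT ltry.
Qed.

Lemma L2_bounded_continuous f : continuous (f : circle R -> R[i]^o) ->
  (forall x, `|f x| <= 1) -> L2 mu f.
Proof.
move=> cf fb; split; apply: Lfun2_bounded => [|x].
- apply: measurable_circle_continuous; exact: continuous_Re_comp.
- by rewrite -lecR (le_trans (normc_ge_Re _)).
- apply: measurable_circle_continuous; exact: continuous_Im_comp.
- rewrite -lecR -normrN -(ReiNIm (f x)) (le_trans (normc_ge_Re _)) // normrM.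
  have -> : `|'i%C : R[i]| = 1 by rewrite normc_def /= expr0n add0r expr1n sqrtr1.
  by rewrite mulr1.
Qed.

(** A product of two real L^2 functions is integrable by Hoelder; the real and imaginary parts are a
    sum and a difference of such products. *)
Lemma L2_cintegrable f g : L2 mu f -> L2 mu g -> cintegrable (fun x => (f x)^* * g x).
Proof.
move=> [f1 f2] [g1 g2].
have mulI (u v : circle R -> R) : u \in Lfun mu 2%:E -> v \in Lfun mu 2%:E ->
    mu.-integrable [set: borel_circle R] (EFin \o (fun x => u x * v x)).
  by move=> uL vL; apply/Lfun1_integrable; exact: Lfun2_mul_Lfun1.
split.
  rewrite (_ : _ \o _ =
      (EFin \o (fun x => (@complex.Re R \o f) x * (@complex.Re R \o g) x)%R) \+
      (EFin \o (fun x => (@complex.Im R \o f) x * (@complex.Im R \o g) x)%R))%E.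
    by apply: integrableD => //; exact: mulI.
  by apply/funext => x /=; rewrite -[_ * _]/((f x)^* * g x) Re_conjM EFinD.
rewrite (_ : _ \o _ =
    (EFin \o (fun x => (@complex.Re R \o f) x * (@complex.Im R \o g) x)%R) \-
    (EFin \o (fun x => (@complex.Im R \o f) x * (@complex.Re R \o g) x)%R))%E.
  by apply: integrableB => //; exact: mulI.
by apply/funext => x /=; rewrite -[_ * _]/((f x)^* * g x) Im_conjM EFinB.
Qed.

Lemma innerDr h f g : L2 mu h -> L2 mu f -> L2 mu g ->
  inner mu h (fun x => f x + g x) = inner mu h f + inner mu h g.
Proof.
move=> hL fL gL; rewrite /inner -cintegralD; try exact: L2_cintegrable.
by congr cintegral; apply/funext => x; rewrite mulrDr.
Qed.

Lemma innerZr h a f : L2 mu h -> L2 mu f ->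
  inner mu h (fun x => a * f x) = a * inner mu h f.
Proof.
move=> hL fL; rewrite /inner -cintegralZ; last exact: L2_cintegrable.
by congr cintegral; apply/funext => x; rewrite mulrCA.
Qed.

Lemma innerC f g : L2 mu f -> L2 mu g -> inner mu g f = (inner mu f g)^*.
Proof.
move=> fL gL; rewrite /inner -cintegral_conj; last exact: L2_cintegrable.
by congr cintegral; apply/funext => x; rewrite rmorphM /= conjCK mulrC.
Qed.

(** If the integral of |f|^2 were zero, |f|^2 would vanish almost everywhere, yet by continuity it
    is positive on a neighbourhood of a support point. *)
Lemma inner_gt0 f (x0 : circle R) : continuous (f : circle R -> R[i]^o) -> L2 mu f ->
  msupport mu x0 -> f x0 != 0 -> 0 < inner mu f f.
Proof.
move=> cf fL x0s fx0; pose u x : R :=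
  complex.Re (f x) * complex.Re (f x) + complex.Im (f x) * complex.Im (f x).
have uE x : (f x)^* * f x = Complex (u x) 0.
  apply/eqP; rewrite eq_complex Re_conjM Im_conjM /u /=.
  by rewrite [complex.Im _ * complex.Re _]mulrC subrr !eqxx.
have [ui _] := L2_cintegrable fL fL.
have {}ui : mu.-integrable [set: borel_circle R] (EFin \o u).
  by apply: eq_integrable ui => //= x _ /=; rewrite uE.
have u_ge0 x : 0 <= u x by rewrite addr_ge0 // -expr2 sqr_ge0.
have cu : continuous u by exact: continuous_sqr_normc.
have -> : inner mu f f = Complex (\int[mu]_x u x) 0.
  rewrite /inner /cintegral; congr Complex.
    by apply: eq_Rintegral => x _; rewrite uE.
  by under eq_Rintegral do rewrite uE /=; rewrite Rintegral_cst // mul0r.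
rewrite ltcE /= eqxx /= lt_def Rintegral_ge0 // andbT; apply/negP => /eqP u0.
have {}u0 : (\int[mu]_x `|(EFin \o u) x| = 0)%E.
  under eq_integral do rewrite /= ger0_norm //.
  have := integrable_fin_num measurableT ui.
  by move=> /fineK <-; rewrite -[fine _]/(\int[mu]_x u x) u0.
have mu_u : measurable_fun [set: borel_circle R] (EFin \o u) by case/integrableP: ui.
have [A [mA A0 uA]] := (ae_eq_integral_abs mu measurableT mu_u).1 u0.
(* This open set contains [x0], so it has positive measure, but it lies in the null set [A]. *)
have oU : open (u @^-1` [set y | 0 < y]).
  by move/continuousP: cu; apply; exact: open_gt.
have /(x0s _ oU) : (u @^-1` [set y | 0 < y]) x0.
  rewrite /= lt_def u_ge0 andbT; apply: contra fx0 => /eqP ux0.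
  have : (f x0)^* * f x0 = 0 by rewrite uE ux0.
  by move/eqP; rewrite mulf_eq0 conjC_eq0 orbb.
rewrite lt_neqAle => /andP[/eqP mu_neq0 _]; apply: mu_neq0.
apply/esym/(subset_measure0 _ mA _ A0).
  exact: sub_sigma_algebra.
by move=> x /= ux; apply: uA => /= /(_ I) [] /eqP; rewrite gt_eqF.
Qed.

End Inner.

(** * Polynomials in L^2 of the circle and the identification of [Phi] *)

Section Circle.
Variables (R : realType) (mu : probability (borel_circle R) R).
Implicit Types (p q : {poly R[i]}) (n k : nat).

(** The form to which the abstract theory is applied. *)
Definition poly_form p q : R[i] :=
  inner mu (fun x : circle R => p.[x]) (fun x : circle R => q.[x]).

Lemma monomialE k : monomial k = fun x : circle R => ('X^k : {poly R[i]}).[x].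
Proof. by apply/funext => x; rewrite hornerXn. Qed.

Lemma L2_monomial k : L2 mu (monomial k).
Proof.
apply: L2_bounded_continuous => [|x]; last by rewrite normrX circle_norm expr1n.
by rewrite monomialE; exact: continuous_circle_horner.
Qed.

Lemma L2_poly p : L2 mu (fun x : circle R => p.[x]).
Proof.
rewrite (_ : (fun x => _) = fun x => \sum_(i < size p) p`_i * monomial i x); last first.
  by apply/funext => x; exact: horner_coef.
elim: (size p) => [|n IH].
  rewrite (_ : (fun x => _) = fun x => 0 * monomial 0 x); first exact/L2Z/L2_monomial.
  by apply/funext => x; rewrite big_ord0 mul0r.
rewrite (_ : (fun x => _) =
  fun x => (\sum_(i < n) p`_i * monomial i x) + p`_n * monomial n x).
  by apply: L2D => //; exact/L2Z/L2_monomial.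
by apply/funext => x; rewrite big_ord_recr.
Qed.

Lemma poly_formDr p q r : poly_form p (q + r) = poly_form p q + poly_form p r.
Proof.
rewrite /poly_form -innerDr; try exact: L2_poly.
by congr inner; apply/funext => x; rewrite hornerD.
Qed.

Lemma poly_formZr p a q : poly_form p (a *: q) = a * poly_form p q.
Proof.
rewrite /poly_form -innerZr; try exact: L2_poly.
by congr inner; apply/funext => x; rewrite hornerZ.
Qed.

Lemma poly_formC p q : poly_form q p = (poly_form p q)^*.
Proof. by apply: innerC; exact: L2_poly. Qed.

Lemma poly_formX p q : poly_form ('X * p) ('X * q) = poly_form p q.
Proof.
rewrite /poly_form /inner; congr cintegral; apply/funext => x.
by rewrite !hornerM !hornerX rmorphM /= mulrACA circle_conj mulVf ?circle_neq0 // mul1r.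
Qed.

Lemma poly_form_gt0 N p : (`I_N.+1 #<= msupport mu)%card ->
  p != 0 -> (size p <= N.+1)%N -> 0 < poly_form p p.
Proof.
move=> /pcard_leP[g] p0 sp.
have [x [xs px]] : exists x, msupport mu x /\ p.[x] != 0; last first.
  by apply: inner_gt0 xs px; [exact: continuous_circle_horner|exact: L2_poly].
apply: contrapT => noroot.
(* The injection [g] of N + 1 indices into the support would give N + 1 distinct roots, more than
   the degree allows. *)
pose rs := [seq circle_val (g i) | i <- iota 0 N.+1].
have rs_roots : all (root p) rs.
  rewrite all_map; apply/allP => i; rewrite mem_iota add0n /= => iN.
  apply: contrapT => /negP pgi; apply: noroot; exists (g i); split => //.
  by have /(_ i iN) := @funS _ _ _ _ g.
have rs_uniq : uniq rs.
  rewrite map_inj_in_uniq ?iota_uniq // => i j; rewrite !mem_iota !add0n => /= iN jN gij.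
  by apply: (@inj _ _ _ g); rewrite ?inE //; exact: val_inj.
by have := max_poly_roots p0 rs_roots rs_uniq; rewrite size_map size_iota ltnNge sp.
Qed.

(** Induction on [n], removing the top monomial. Here [h] is any L^2 function, as the elements of an
    orthogonal complement require. *)
Lemma inner_lower_poly n (h : circle R -> R[i]) p : L2 mu h ->
  (forall k, (k < n)%N -> inner mu h (monomial k) = 0) -> (size p <= n)%N ->
  inner mu h (fun x : circle R => p.[x]) = 0.
Proof.
move=> hL; elim: n p => [|n IH] p h0 sp.
  have -> : (fun x : circle R => p.[x]) = fun x => 0 * monomial 0 x.
    apply/funext => x; move: sp; rewrite leqn0 size_poly_eq0 => /eqP ->.
    by rewrite horner0 mul0r.
  by rewrite innerZr ?mul0r //; exact: L2_monomial.
pose q := p - p`_n *: 'X^n.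
have sq : (size q <= n)%N.
  apply/leq_sizeP => j nj; rewrite coefB coefZ coefXn.
  have [->|jn] := eqVneq j n; first by rewrite mulr1 subrr.
  by rewrite mulr0 subr0 nth_default // (leq_trans sp) // ltn_neqAle eq_sym jn.
have -> : (fun x : circle R => p.[x]) = fun x => q.[x] + p`_n * monomial n x.
  by apply/funext => x; rewrite !hornerE subrK.
have mL := L2_monomial n.
rewrite (innerDr hL (L2_poly q) (L2Z p`_n mL)) (innerZr _ hL mL) h0 // mulr0 addr0.
by apply: IH => // k kn; rewrite h0 // ltnW.
Qed.

(** Membership in the complement is orthogonality to lower monomials. Conversely z^n - p has degree
    below [n], hence is orthogonal to the whole complement. *)
Lemma is_monic_orthogonal_polyP n p :
  is_monic_orthogonal_poly mu n p <-> monic_orthogonal poly_form n p.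
Proof.
split=> [[pm sp [[_ po] _]]|[pm sp po]].
  split=> // k kn; rewrite /poly_form -monomialE; apply: po.
  by exists k.
split=> //; split=> [|h [hL h0]].
  split=> [|_ [k /= kn <-]]; first exact: L2_poly.
  by rewrite monomialE; exact: po.
have -> : monomial n - (fun x : circle R => p.[x]) = fun x : circle R => ('X^n - p).[x].
  by apply/funext => x; rewrite hornerD hornerN hornerXn.
apply: (@inner_lower_poly n) => // [k kn|].
  by rewrite innerC ?h0 ?conjC0 //; [exists k|exact: L2_monomial].
by apply: size_monic_subr; rewrite ?monicXn ?size_polyXn.
Qed.

(** On the circle 1 / conj z = z, so the value is z^n times the conjugate of p(z), and conjugate
    powers of z are inverse powers. *)
Lemma Phi_star_reversed n (p := Phi mu n) : (size p <= n.+1)%N ->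
  Phi_star mu n = fun x : circle R => (reversed_poly n p).[x].
Proof.
move=> sp; apply/funext => x; rewrite /Phi_star -/p circle_conj div1r invrK.
rewrite (horner_coef_wide _ sp) rmorph_sum horner_poly mulr_sumr /=.
rewrite [RHS](reindex_inj rev_ord_inj) /=; apply: eq_bigr => i _.
rewrite subSS subKn ?leq_ord // rmorphM rmorphXn /= circle_conj mulrCA; congr (_ * _).
by rewrite exprVn expfB_cond // (negbTE (circle_neq0 x)) leq_ord.
Qed.

(** Existence, supplied by the recursion, rules out the default value 0 in the choice of [Phi]. *)
Lemma Phi_monic_orthogonal N n : (`I_N.+1 #<= msupport mu)%card -> (n <= N)%N ->
  monic_orthogonal poly_form n (Phi mu n).
Proof.
move=> hsupp nN.
have [p pP] := monic_orthogonal_exists poly_formDr poly_formZr poly_formC poly_formX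
  (fun p => @poly_form_gt0 N p hsupp) (leqW nN).
apply/is_monic_orthogonal_polyP; apply: (@xgetPex _ 0).
by exists p; exact/is_monic_orthogonal_polyP.
Qed.

Lemma inner_phi_star_phi N k : (`I_N.+1 #<= msupport mu)%card -> (k <= N)%N ->
  inner mu (phi_star mu N) (phi mu k) = (Phi mu k)`_0 *
    (sqrtC (poly_form (Phi mu N) (Phi mu N)) / sqrtC (poly_form (Phi mu k) (Phi mu k))).
Proof.
move=> hsupp kN; have PN := Phi_monic_orthogonal hsupp (leqnn N).
have Pk := Phi_monic_orthogonal hsupp kN.
have [_ sN _] := PN; have [_ sk _] := Pk.
set a := sqrtC _; set b := sqrtC (poly_form (Phi mu k) _).
have nN_gt0 : 0 < poly_form (Phi mu N) (Phi mu N).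
  by apply: (poly_form_gt0 hsupp); rewrite ?sN // -size_poly_eq0 sN.
have a_gt0 : 0 < a by rewrite sqrtC_gt0.
have -> : phi_star mu N = fun x : circle R => (a^-1 *: reversed_poly N (Phi mu N)).[x].
  by apply/funext => x; rewrite /phi_star Phi_star_reversed ?sN // hornerZ mulrC.
have -> : phi mu k = fun x : circle R => (b^-1 *: Phi mu k).[x].
  by apply/funext => x; rewrite /phi hornerZ mulrC.
rewrite -/(poly_form _ _) poly_formZr poly_formC poly_formZr rmorphM /= -poly_formC.
rewrite (reversed_eval0 poly_formDr poly_formZr poly_formC poly_formX PN) ?sk //.
(* Since [a] is a positive real, its inverse is self-conjugate, and one factor [a] of <Phi_N, Phi_N>
   = a^2 survives. *)
rewrite conj_Creal ?rpredV ?gtr0_real // -[poly_form _ _]sqrtCK -/a.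
by rewrite [a^-1 * _]mulrCA expr2 mulKf ?gt_eqF // mulrCA [b^-1 * _]mulrC.
Qed.

End Circle.

(** * The coordinates of [z] in terms of canonical moments, and the ball *)

Theorem mainTheorem12 (R : realType) (N : nat) (hN : (1 <= N)%N)
    (mu : probability (borel_circle R) R)
    (hsupp : (`I_N.+1 #<= msupport mu)%card) :
  let c : nat -> R[i] := canonical_moment mu in
  let pi_ (k : nat) : R[i] := inner mu (phi_star mu N) (phi mu k) in
  let z (j : nat) : R[i] := pi_ (N.+1 - j)%N in
  let kappa (r : nat) : R[i] := - (c (N.+1 - r)%N)^* in
  [/\ complex_ball (\row_(i < N) z i.+1),
      z 1%N = kappa 1%N &
      forall j : nat, (2 <= j <= N)%N ->
        z j = kappa j * \prod_(1 <= s < j) sqrtC (1 - `|kappa s| ^+ 2)].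
Proof.
move=> c pi_ z kappa.
have PP k : (k <= N)%N -> monic_orthogonal (poly_form mu) k (Phi mu k).
  exact: Phi_monic_orthogonal.
have form_gt0 p := @poly_form_gt0 _ mu N p hsupp.
have kappaE j : kappa j = (Phi mu (N.+1 - j))`_0.
  by rewrite /kappa /c /canonical_moment rmorphN /= opprK conjCK horner_coef0.
(* The case j = 1 is included, with an empty product. *)
have zE j : (1 <= j <= N)%N ->
    z j = kappa j * \prod_(1 <= s < j) sqrtC (1 - `|kappa s| ^+ 2).
  move=> /andP[j1 jN]; under eq_bigr do rewrite kappaE.
  rewrite kappaE -(sqrt_norm_ratio (poly_formDr mu) (poly_formZr mu) (poly_formC mu)
    (poly_formX mu) form_gt0 PP) ?j1 ?(leqW jN) //.
  by apply: inner_phi_star_phi => //; rewrite leq_subLR -add1n leq_add2r.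
split=> [||j /andP[j2 jN]].
- rewrite /complex_ball /=.
  (* The coordinate of index [i], counted from 0, is pi_(N-i). *)
  under eq_bigr => i _.
    rewrite mxE /z /pi_ subSS inner_phi_star_phi ?leq_subr //. over.
  rewrite (sum_sqr_projections (poly_formDr mu) (poly_formZr mu) (poly_formC mu)
    (poly_formX mu) form_gt0 PP) gtrBl.
  (* What is subtracted from 1 is a quotient of two positive squared norms. *)
  by rewrite divr_gt0 //; apply: (monic_orthogonal_gt0 form_gt0 _ (PP _ _)).
- by rewrite zE ?hN // big_geq // mulr1.
- by rewrite zE // (ltnW j2).
Qed.
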